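(* Let $q\ge2$, $\ell\ge1$, $n\ge\ell$ be integers. There exist integers $\boldsymbol{a}=(a_1,\dots,a_{n-\ell+1})$ with $0\le a_i\le i$ for all $i$, such that the code \[\mathcal{C}_1(n)=\{\boldsymbol{x}\in\mathbb{Z}_q^n:\ \sigma_\ell(\boldsymbol{v})\in\mathcal{VT}_{a_{\omega+1}}(\omega+1)\},\] where $\phi_\ell(\boldsymbol{x})=(\boldsymbol{u},\boldsymbol{v})$ is the $\ell$-step derivative of $\boldsymbol{x}$ and $\omega=wt_{\mathrm H}(\boldsymbol{v})$, has cardinality \[|\mathcal{C}_1(n)|\ge q^\ell\sum_{\nu=0}^{\lfloor n/\ell\rfloor-1}\ \sum_{\omega=0}^{n-(\nu+1)\ell}A(n-(\nu+1)\ell,\ell-1,\omega)\,\frac{\binom{\omega+\nu}{\nu}}{\omega+2}.\]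
   Context: For $\boldsymbol{x}\in\mathbb{Z}_q^n$, $n\ge\ell$, the $\ell$-step derivative is $\phi_\ell(\boldsymbol{x})=(\boldsymbol{u},\boldsymbol{v})$ with $\boldsymbol{u}=(x_1,\dots,x_\ell)$ and $\boldsymbol{v}=(x_{\ell+1},\dots,x_n)-(x_1,\dots,x_{n-\ell})\in\mathbb{Z}_q^{n-\ell}$. $wt_{\mathrm H}$ denotes Hamming weight. Write $\boldsymbol{v}=(0^{m_0},w_1,0^{m_1},w_2,\dots,w_p,0^{m_p})$ with $w_i\in\mathbb{Z}_q\setminus\{0\}$, $m_i\ge 0$, $p=wt_{\mathrm H}(\boldsymbol{v})$, where $0^m$ is the $m$-fold repetition of $0$. The $\ell$-zero signature of $\boldsymbol{v}$ is $\sigma_\ell(\boldsymbol{v})=(\lfloor m_0/\ell\rfloor,\dots,\lfloor m_p/\ell\rfloor)\in\mathbb{N}_0^{p+1}$. For $0\le a\le m$, $\mathcal{VT}_a(m)=\{\boldsymbol{x}\in\mathbb{N}_0^m:\ \sum_{i=1}^m i\,x_i\equiv a\pmod{m+1}\}$. $A(n',\ell',\omega)$ is the number of words in $\mathbb{Z}_q^{n'}$ of Hamming weight $\omega$ in which every run of consecutive zeros has length at most $\ell'$ (for $n'=0$ the only word is the empty word, of weight $0$). *)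

(* Defs.v *)
From mathcomp Require Import all_boot all_order all_algebra.

Set Implicit Arguments.
Unset Strict Implicit.
Unset Printing Implicit Defensive.

Import GRing.Theory.
Local Open Scope ring_scope.

(* Words of length n over Z_q are n.-tuple 'Z_q; the operations below act on  *)
(* the underlying sequences.  'Z_q is the ring of integers modulo q only when *)
(* 1 < q.                                                                     *)

Definition hamming_wt (V : zmodType) (v : seq V) : nat :=
  count (fun w => w != 0) v.

(* Meaningful for l <= size x. *)
Definition step_derivative (V : zmodType) (l : nat) (x : seq V) :
    seq V * seq V :=
  (take l x,
   [seq y.1 - y.2 | y <- zip (drop l x) (take (size x - l)%N x)]).

(* The sequence m_0, ..., m_p in v = 0^{m_0} w_1 0^{m_1} ... w_p 0^{m_p} with *)
(* all w_i nonzero; see zero_runsE and size_zero_runs.                        *)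
Fixpoint zero_runs (V : zmodType) (v : seq V) : seq nat :=
  if v is w :: v' then
    if w == 0 then incr_nth (zero_runs v') 0 else 0%N :: zero_runs v'
  else [:: 0%N].

Lemma size_zero_runs (V : zmodType) (v : seq V) :
  size (zero_runs v) = (hamming_wt v).+1.
Proof.
elim: v => //= w v IHv; case: eqP => _ /=; last by rewrite IHv.
by rewrite size_incr_nth IHv.
Qed.

Lemma zero_runsE (V : zmodType) (v : seq V) :
  v = nseq (head 0%N (zero_runs v)) 0 ++
      flatten [seq y.1 :: nseq y.2 0
              | y <- zip [seq w <- v | w != 0] (behead (zero_runs v))].
Proof.
elim: v => //= w v IHv; have := size_zero_runs v.
case: (zero_runs v) IHv => //= m r IHv _.
by case: eqP => [->|_] /=; rewrite {1}IHv.
Qed.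

Definition zero_signature (V : zmodType) (l : nat) (v : seq V) : seq nat :=
  [seq (m %/ l)%N | m <- zero_runs v].

(* x_i is nth 0 x i.-1. *)
Definition VT (a m : nat) (x : seq nat) : bool :=
  (size x == m) &&
  (\sum_(1 <= i < m.+1) i * nth 0 x i.-1 == a %[mod m.+1])%N.

Definition A (q n l w : nat) : nat :=
  #|[set x : n.-tuple 'Z_q |
      (hamming_wt x == w) && all (fun m => m <= l)%N (zero_runs x)]|.

(* a_{w+1} is nth 0 a w, in range since w <= n - l. *)
Definition code1 (q l n : nat) (a : seq nat) : {set n.-tuple 'Z_q} :=
  [set x : n.-tuple 'Z_q |
    let v := (step_derivative l x).2 in
    let w := hamming_wt v in
    VT (nth 0%N a w) w.+1 (zero_signature l v)].

(* Main.v *)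
Require Import Defs.
From mathcomp Require Import all_boot all_order all_algebra.

Set Implicit Arguments.
Unset Strict Implicit.
Unset Printing Implicit Defensive.

Import Order.TTheory GRing.Theory Num.Theory.
Local Open Scope ring_scope.

(* The l-step derivative is a bijection onto pairs (u, v), so the code has    *)
(* q^l times as many words as there are admissible v.  Among the M_w words v  *)
(* of weight w, the w+2 possible values of the VT sum modulo w+2 leave, by    *)
(* pigeonhole, a class with at least M_w/(w+2) words.  Finally, taking l      *)
(* times s_i zeros away from the i-th zero run, s being the signature of v,   *)
(* identifies the v of weight w with signature sum nu with pairs made of a    *)
(* word whose zero runs are shorter than l and a composition of nu into w+1   *)
(* nonnegative parts; there are 'C(w + nu, nu) of the latter.                 *)

(** The difference word [v] has length [N = n - l] and alone decides membership, while [u] is free;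
    [card_code1] turns this into the factor [q ^ l]. The VT residue may be chosen separately for
    each weight [w], and [pigeonhole_modn] finds one that keeps at least the fraction [1 / w.+2] of
    the sphere of weight [w]. It remains to bound that sphere from below. Padding the runs of a
    short-run word by multiples [s_i * l] is reversible: Euclidean division of each run length by
    [l] returns [s] as quotients and the old runs as remainders ([pad_runs_inj]). Summing over the
    disjoint classes [sumn s = nu] gives [card_hamming_sphere_ge], and exchanging the sums over [nu]
    and [w] concludes. *)

Section ZeroRuns.
Variable V : zmodType.
Implicit Types (m : seq nat) (c v : seq V).

(** This is the right-hand side of [zero_runsE] with the runs and the nonzero letters made
    independent, so that runs can be altered while the letters stay fixed. *)
Definition of_runs m c : seq V :=
  nseq (head 0%N m) 0 ++
    flatten [seq y.1 :: nseq y.2 0 | y <- zip c (behead m)].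

Lemma zero_runs_nseq_cat k v :
  zero_runs (nseq k 0 ++ v) =
    (k + head 0 (zero_runs v))%N :: behead (zero_runs v).
Proof.
elim: k => [|k IHk] /=; last by rewrite eqxx IHk.
by have := size_zero_runs v; case: (zero_runs v).
Qed.

Lemma zero_runs_of_runs m c :
  size m = (size c).+1 -> all (fun w => w != 0) c ->
  zero_runs (of_runs m c) = m.
Proof.
elim: c m => [|w c IHc] [|k [|k' m]] //= sz; rewrite /of_runs /=.
  by rewrite zero_runs_nseq_cat /= addn0.
case: sz => sz /andP[/negPf w0 c0]; rewrite zero_runs_nseq_cat /= w0 /= addn0.
by have /= := IHc (k' :: m); rewrite /of_runs /= => -> //; rewrite sz.
Qed.

Lemma filter_of_runs m c :
  size m = (size c).+1 -> all (fun w => w != 0) c ->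
  [seq w <- of_runs m c | w != 0] = c.
Proof.
have fn k : [seq w <- nseq k (0 : V) | w != 0] = [::].
  by rewrite filter_nseq eqxx.
elim: c m => [|w c IHc] [|k [|k' m]] //= sz; rewrite /of_runs /=.
  by rewrite cats0 fn.
case: sz => sz /andP[w0 c0]; rewrite filter_cat fn /= w0 /=.
by have /= := IHc (k' :: m); rewrite /of_runs /= => -> //; rewrite sz.
Qed.

Lemma size_of_runs m c :
  size m = (size c).+1 -> size (of_runs m c) = (sumn m + size c)%N.
Proof.
elim: c m => [|w c IHc] [|k [|k' m]] //= sz; rewrite /of_runs /=.
  by rewrite cats0 size_nseq !addn0.
case: sz => sz; rewrite size_cat size_nseq /=.
by have /= := IHc (k' :: m); rewrite /of_runs /= => ->; rewrite ?sz ?addnS ?addnA.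
Qed.

Lemma of_runsK v : of_runs (zero_runs v) [seq w <- v | w != 0] = v.
Proof. by rewrite /of_runs -zero_runsE. Qed.

Lemma sumn_zero_runs v : (sumn (zero_runs v) + hamming_wt v)%N = size v.
Proof.
rewrite -[in RHS](of_runsK v) size_of_runs size_filter //.
by rewrite size_zero_runs.
Qed.

Definition pad_runs (l : nat) (s : seq nat) v : seq V :=
  of_runs [seq (y.1 + y.2 * l)%N | y <- zip (zero_runs v) s]
          [seq w <- v | w != 0].

Section PadRuns.
Variables (l : nat) (s : seq nat) (v : seq V).
Hypothesis sz_s : size s = (hamming_wt v).+1.

Let sz_runs :
  size [seq (y.1 + y.2 * l)%N | y <- zip (zero_runs v) s] =
    (size [seq w <- v | w != 0%R]).+1.
Proof. by rewrite size_map size_zip size_zero_runs sz_s minnn size_filter. Qed.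

Lemma zero_runs_pad_runs :
  zero_runs (pad_runs l s v) =
    [seq (y.1 + y.2 * l)%N | y <- zip (zero_runs v) s].
Proof. by rewrite zero_runs_of_runs ?filter_all. Qed.

Lemma filter_pad_runs :
  [seq w <- pad_runs l s v | w != 0] = [seq w <- v | w != 0].
Proof. by rewrite filter_of_runs ?filter_all. Qed.

Lemma hamming_wt_pad_runs : hamming_wt (pad_runs l s v) = hamming_wt v.
Proof. by rewrite /hamming_wt -!size_filter filter_pad_runs. Qed.

Lemma size_pad_runs : size (pad_runs l s v) = (size v + sumn s * l)%N.
Proof.
rewrite size_of_runs // size_filter -(sumn_zero_runs v) addnAC; congr addn.
have : size (zero_runs v) = size s by rewrite size_zero_runs sz_s.
elim: (zero_runs v) s => [|k r IHr] [|j t] //= [/IHr ->].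
by rewrite mulnDl addnACA.
Qed.

Hypothesis short_v : all (fun k => k < l)%N (zero_runs v).

Lemma zero_signature_pad_runs : zero_signature l (pad_runs l s v) = s.
Proof.
rewrite /zero_signature zero_runs_pad_runs.
have : size (zero_runs v) = size s by rewrite size_zero_runs sz_s.
elim: (zero_runs v) s short_v => [|k r IHr] [|j t] //= /andP[kl rl] [/IHr ->] //.
by rewrite addnC divnMDl ?(leq_trans _ kl) // divn_small ?addn0.
Qed.

Lemma modn_zero_runs_pad_runs :
  [seq (k %% l)%N | k <- zero_runs (pad_runs l s v)] = zero_runs v.
Proof.
rewrite zero_runs_pad_runs.
have : size (zero_runs v) = size s by rewrite size_zero_runs sz_s.
elim: (zero_runs v) s short_v => [|k r IHr] [|j t] //= /andP[kl rl] [/IHr ->] //.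
by rewrite addnC modnMDl modn_small.
Qed.

End PadRuns.

Lemma pad_runs_inj l s t v v' :
    size s = (hamming_wt v).+1 -> size t = (hamming_wt v').+1 ->
    all (fun k => k < l)%N (zero_runs v) ->
    all (fun k => k < l)%N (zero_runs v') ->
  pad_runs l s v = pad_runs l t v' -> s = t /\ v = v'.
Proof.
move=> szs szt sv sv' e; split.
  by rewrite -(zero_signature_pad_runs szs sv) e zero_signature_pad_runs.
rewrite -(of_runsK v) -(of_runsK v').
rewrite -(modn_zero_runs_pad_runs szs sv) -(filter_pad_runs l szs) e.
by rewrite modn_zero_runs_pad_runs ?filter_pad_runs.
Qed.

Lemma size_step_derivative (l : nat) v :
  size (step_derivative l v).2 = (size v - l)%N.
Proof.
rewrite size_map size_zip size_drop size_take_min.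
by rewrite (minn_idPl (leq_subr _ _)) minnn.
Qed.

(** The first [l] letters are given; each later one is [v_(i-l) + x_(i-l)], where [i - l < i]
    because [l] is positive, so strong induction on the index applies. *)
Lemma step_derivative_inj (l : nat) v v' :
  (0 < l)%N -> size v = size v' -> step_derivative l v = step_derivative l v' ->
  v = v'.
Proof.
move=> l0 sz [eu ev]; apply: (@eq_from_nth _ 0 _ _ sz) => i.
have [k] := ubnP i; elim: k i => // k IHk i /ltnSE ik isz.
have [il|li] := ltnP i l.
  by rewrite -(nth_take 0 il) eu nth_take.
have nthv (x : seq V) : (i < size x)%N ->
    nth 0 (step_derivative l x).2 (i - l) = nth 0 x i - nth 0 x (i - l).
  move=> ix; have ixl : (i - l < size x - l)%N by rewrite ltn_sub2r ?(leq_ltn_trans li).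
  have szz : size (drop l x) = size (take (size x - l) x).
    by rewrite size_drop size_take_min (minn_idPl (leq_subr _ _)).
  rewrite (nth_map (0, 0)); last first.
    by rewrite size_zip -szz minnn size_drop.
  by rewrite nth_zip //= nth_drop subnKC // nth_take.
have e := nthv v isz; rewrite /= ev -/((step_derivative l v').2) in e.
rewrite nthv -?sz // in e.
have il : (i - l < i)%N by rewrite ltn_subrL l0 (leq_trans l0 li).
have := IHk _ (leq_trans il ik) (ltn_trans il isz).
by move=> ei; rewrite ei in e; apply/esym/(addIr _ e).
Qed.

End ZeroRuns.

(** Serves three partitions: by residue, by signature sum and by Hamming weight. *)
Lemma card_fibers (T : finType) (B : {set T}) (f : T -> nat) (k : nat) :
  (\sum_(0 <= j < k) #|[set x in B | f x == j]| =
   #|[set x in B | f x < k]|)%N.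
Proof.
elim: k => [|k IHk].
  rewrite big_geq // (_ : finset _ = set0) ?cards0 //.
  by apply/setP => x; rewrite !inE andbF.
rewrite big_nat_recr //= IHk -cardsUI addnC -[RHS]add0n; congr addn.
  apply/eqP; rewrite cards_eq0; apply/eqP/setP => x; rewrite !inE.
  by case: eqP => [->|]; rewrite ?ltnn ?andbF.
by apply: eq_card => x; rewrite !inE -andb_orr orbC -leq_eqVlt.
Qed.

Lemma pigeonhole_modn (T : finType) (B : {set T}) (f : T -> nat) (k : nat) :
  exists2 a, (a <= k)%N &
    (#|B| <= k.+1 * #|[set x in B | f x == a %[mod k.+1]]|)%N.
Proof.
pose F (i : 'I_k.+1) := #|[set x in B | f x %% k.+1 == i :> nat]|%N.
(* The witness is the residue with the largest class, which is at least the average. *)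
case: (@arg_maxnP _ ord0 xpredT F isT) => i _ maxi.
exists i; first exact: leq_ord.
have -> : #|B| = (\sum_(j < k.+1) F j)%N.
  rewrite -(big_mkord xpredT (fun j => #|[set x in B | f x %% k.+1 == j]|%N)).
  by rewrite card_fibers; apply: eq_card => x; rewrite !inE ltn_mod andbT.
rewrite modn_small // -[X in (_ <= X * _)%N]card_ord -sum_nat_const.
by apply: leq_sum => j _; apply: maxi.
Qed.

Section Counting.
Variables (q l : nat).
Hypothesis l_gt0 : (0 < l)%N.

(** The binomial counts the tuples of [w.+1] naturals with sum [nu]; padding sends pairs (short-run
    word, tuple) injectively into the set on the right. *)
Lemma card_signature_sum (N w nu : nat) :
  (nu * l <= N)%N ->
  (A q (N - nu * l) l.-1 w * 'C(w + nu, nu) <=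
   #|[set v : N.-tuple 'Z_q | (hamming_wt v == w) &
                              (sumn (zero_signature l v) == nu)]|)%N.
Proof.
move=> nuN.
have -> : 'C(w + nu, nu) = 'C(w + nu, w).
  by rewrite -(bin_sub (leq_addl _ _)) addnK.
rewrite -card_ord_partitions /A -cardsX.
set P := setX _ _.
pose pad (z : (N - nu * l).-tuple 'Z_q * w.+1.-tuple 'I_nu.+1) : N.-tuple 'Z_q :=
  (* The default word is never reached on [P]: there the padded length is
     [N - nu * l + nu * l = N]. *)
  insubd (nseq_tuple N 0) (pad_runs l (map val z.2) z.1).
have inP z : z \in P ->
    [/\ size (map val z.2) = (hamming_wt z.1).+1, hamming_wt z.1 = w,
        all (fun k => k < l)%N (zero_runs z.1), sumn (map val z.2) = nu
      & val (pad z) = pad_runs l (map val z.2) z.1].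
  case: z => v s; rewrite !inE /= => /andP[/andP[/eqP wt_v sv] /eqP sum_s].
  have szs : size (map val s) = (hamming_wt v).+1 by rewrite size_map size_tuple wt_v.
  have ss : sumn (map val s) = nu.
    by rewrite sumnE big_map.
  split=> //; first by apply: sub_all sv => k kl; rewrite -(prednK l_gt0) ltnS.
  by rewrite val_insubd size_pad_runs //= size_tuple ss subnK // eqxx.
rewrite -(card_in_imset (f := pad)); last first.
  move=> [v s] [v' s'] /inP[/= szs _ sv _ e] /inP[/= szs' _ sv' _ e'].
  move/(congr1 val); rewrite /= in e e' *; rewrite e e' => /pad_runs_inj[] // es ev.
  congr pair; apply/val_inj => //.
  exact: (inj_map val_inj).
apply/subset_leq_card/subsetP => _ /imsetP[z /inP[szs wt_z sz ss e] ->].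
rewrite inE /= in e *; rewrite e hamming_wt_pad_runs // wt_z eqxx.
by rewrite zero_signature_pad_runs // ss eqxx.
Qed.

Lemma card_hamming_sphere_ge (N w : nat) :
  (\sum_(0 <= nu < (N %/ l).+1) A q (N - nu * l) l.-1 w * 'C(w + nu, nu) <=
   #|[set v : N.-tuple 'Z_q | hamming_wt v == w]|)%N.
Proof.
pose f (v : N.-tuple 'Z_q) := sumn (zero_signature l v).
pose B := [set v : N.-tuple 'Z_q | hamming_wt v == w].
apply: (@leq_trans #|[set v in B | (f v < (N %/ l).+1)%N]|); last first.
  by apply/subset_leq_card/subsetP => v; rewrite inE => /andP[].
rewrite -card_fibers big_nat_cond [leqRHS]big_nat_cond.
apply: leq_sum => nu /andP[/andP[_ nuN] _].
apply: leq_trans (card_signature_sum _ _) _; first by rewrite -leq_divRL.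
by apply/subset_leq_card/subsetP => v; rewrite !inE.
Qed.

Lemma card_code1 (n : nat) (a : seq nat) : (1 < q)%N -> (l <= n)%N ->
  #|code1 q l n a| =
    (q ^ l * #|[set v : (n - l).-tuple 'Z_q |
      VT (nth 0 a (hamming_wt v)) (hamming_wt v).+1 (zero_signature l v)]|)%N.
Proof.
move=> q1 ln; set D := [set v | _].
have szu (x : n.-tuple 'Z_q) : size (step_derivative l x).1 == l.
  by rewrite /= size_takel // size_tuple.
have szv (x : n.-tuple 'Z_q) : size (step_derivative l x).2 == (n - l)%N.
  by rewrite size_step_derivative size_tuple.
pose phi x := (Tuple (szu x), Tuple (szv x)).
have phi_inj : injective phi.
  move=> x y [eu ev]; apply/val_inj/(step_derivative_inj l_gt0).
    by rewrite !size_tuple.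
  by rewrite [LHS]surjective_pairing [RHS]surjective_pairing /= eu ev.
(* An injection between sets of equal size, as [q^n = q^l * q^(n-l)] in cardinalities. *)
have phi_bij : bijective phi.
  apply: inj_card_bij phi_inj _.
  by rewrite card_prod !card_tuple -expnD subnKC.
have -> : code1 q l n a = phi @^-1: setX [set: l.-tuple 'Z_q] D.
  by apply/setP => x; rewrite !inE.
rewrite on_card_preimset; last exact: onW_bij.
by rewrite cardsX cardsT card_tuple card_ord [in X in (X ^ _)%N]Zp_cast.
Qed.

End Counting.

Theorem lemma4 (q l n : nat) (hq : (2 <= q)%N) (hl : (1 <= l)%N)
    (hn : (l <= n)%N) :
  exists a : (n - l).+1.-tuple nat,
    (forall i : 'I_(n - l).+1, (tnth a i <= i.+1)%N) /\
    (q ^ l)%:R *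
      (\sum_(0 <= nu < n %/ l) \sum_(0 <= w < (n - nu.+1 * l).+1)
         (A q (n - nu.+1 * l) l.-1 w)%:R * ('C(w + nu, nu)%:R / w.+2%:R))
    <= #|code1 q l n a|%:R :> rat.
Proof.
set N := (n - l)%N.
pose S w := [set v : N.-tuple 'Z_q | hamming_wt v == w].
pose vt w (v : N.-tuple 'Z_q) :=
  (\sum_(1 <= i < w.+2) i * nth 0 (zero_signature l v) i.-1)%N.
have pig w : exists a, (a <= w.+1)%N &&
    (#|S w| <= w.+2 * #|[set v in S w | vt w v == a %[mod w.+2]]|)%N.
  by have [a aw Sa] := pigeonhole_modn (S w) (vt w) w.+1; exists a; rewrite aw.
(* Index [w] holds the residue for weight [w], that is, a_(w+1), hence the bound [i.+1]. *)
pose b w := xchoose (pig w).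
have bP w := andP (xchooseP (pig w)).
exists [tuple b i | i < N.+1]; split=> [i|].
  by rewrite tnth_mktuple; case: (bP i).
rewrite card_code1 // natrM ler_wpM2l ?ler0n //.
set D := [set v | _].
have -> : #|D| = (\sum_(0 <= w < N.+1) #|[set v in D | hamming_wt v == w]|)%N.
  rewrite card_fibers; apply: eq_card => v; rewrite inE andb_idr // => _.
  by rewrite ltnS -[X in (_ <= X)%N](size_tuple v) count_size.
rewrite natr_sum.
(* Matches the range of [nu] in the theorem with that of the sphere bound at length [N]. *)
have -> : (n %/ l = (N %/ l).+1)%N.
  by rewrite divnBr ?divnn ?hl ?dvdnn // subn1 prednK // divn_gt0.
apply: le_trans (_ : \sum_(0 <= w < N.+1) #|S w|%:R / w.+2%:R <= _); last first.
  apply: ler_sum_nat => w /andP[_ wN].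
  rewrite ler_pdivrMr ?ltr0n // -natrM ler_nat mulnC.
  case: (bP w) => _ /leq_trans; apply; rewrite leq_mul2l; apply/orP; right.
  apply/subset_leq_card/subsetP => v; rewrite !inE => /andP[/eqP wt_v vtv].
  rewrite wt_v eqxx andbT /VT size_map size_zero_runs wt_v eqxx /=.
  by rewrite (nth_map (Ordinal wN)) ?size_enum_ord // nth_enum_ord.
(* Extending the range of [w] up to [N] adds only nonnegative terms and makes it independent of
   [nu], so that the two sums can be exchanged. *)
apply: le_trans (_ : \sum_(0 <= nu < (N %/ l).+1) \sum_(0 <= w < N.+1)
   (A q (N - nu * l) l.-1 w)%:R * ('C(w + nu, nu)%:R / w.+2%:R) <= _).
  apply: ler_sum => nu _; rewrite mulSn subnDA -/N.
  rewrite [leRHS](big_cat_nat (leq0n (N - nu * l).+1)) ?ltnS ?leq_subr //=.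
  by rewrite lerDl sumr_ge0 // => w _; rewrite !(mulr_ge0, invr_ge0, ler0n).
rewrite exchange_big /=; apply: ler_sum => w _.
under eq_bigr do rewrite mulrA.
rewrite -mulr_suml ler_wpM2r ?invr_ge0 ?ler0n //.
under eq_bigr do rewrite -natrM.
by rewrite -natr_sum ler_nat card_hamming_sphere_ge.
Qed.
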